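(* Let $U$ and $V$ be independent random variables and let $\hat\beta=\hat\beta_n(U,V)$, $n=1,2,\ldots$, be an estimator (a sequence of measurable functions of $(U,V)$ with values in $\mathbb R^p$). If there exists a set $\mathcal U$ such that $\mathrm{pr}(U\in\mathcal U)=1$ and for all $u\in\mathcal U$, $\hat\beta$ converges in probability to $\beta^*$ conditional on $U=u$ (that is, $\hat\beta_n(u,V)\to\beta^*$ in probability as $n\to\infty$), then $\hat\beta$ converges unconditionally to $\beta^*$, i.e., $\hat\beta_n(U,V)\to\beta^*$ in probability as $n\to\infty$.
   Context: $U$ and $V$ may take values in general measurable spaces (for instance function spaces); $\beta^*\in\mathbb R^p$ is a fixed constant. *)

(* Defs.v *)
From HB Require Import structures.
From mathcomp Require Import all_boot all_order all_algebra.
From mathcomp Require Import all_classical all_reals all_analysis.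

Set Implicit Arguments.
Unset Strict Implicit.
Unset Printing Implicit Defensive.

Import Order.TTheory GRing.Theory Num.Theory.
Import numFieldNormedType.Exports.

Local Open Scope classical_set_scope.
Local Open Scope ring_scope.
Local Open Scope ereal_scope.

Definition independent_RVs (R : realType) (d d1 d2 : measure_display)
    (Omega : measurableType d) (T1 : measurableType d1)
    (T2 : measurableType d2) (P : probability Omega R)
    (X : {RV P >-> T1}) (Y : {RV P >-> T2}) : Prop :=
  forall (A : set T1) (B : set T2), measurable A -> measurable B ->
    P ((X @^-1` A) `&` (Y @^-1` B)) = P (X @^-1` A) * P (Y @^-1` B).

(* E carries the Borel sigma-algebra; for a finite power of R this is the
   usual product sigma-algebra. *)
Definition borel_measurable (d : measure_display) (T : measurableType d)
    (E : ptopologicalType) (f : T -> E) : Prop :=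
  measurable_fun [set: T] (f : T -> g_sigma_algebraType (@open E)).

(* On 'rV[R]_p the norm `|_| is the max norm; as all norms on R^p are
   equivalent, the notion does not depend on this choice. *)
Definition cvg_in_probability (R : realType) (d : measure_display)
    (Omega : measurableType d) (P : probability Omega R)
    (E : normedModType R) (X : nat -> Omega -> E) (l : E) : Prop :=
  forall e : R, (0 < e)%R ->
    (fun n => P [set w | (e < `|X n w - l|)%R]) @ \oo --> 0.

(* Main.v *)
(* By independence the joint law of (U, V) is the product of the marginal laws,
   so Fubini gives P(|betahat_n(U, V) - betastar| > e) = E[q_n(U)], where
   q_n(u) = P(|betahat_n(u, V) - betastar| > e). These functions are bounded by
   1 and q_n(U) tends to 0 almost surely, so dominated convergence applies. *)

Require Import Defs.
From HB Require Import structures.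
From mathcomp Require Import all_boot all_order all_algebra.
From mathcomp Require Import all_classical all_reals all_analysis.
From mathcomp Require Import measurable_realfun.

Import Order.TTheory GRing.Theory Num.Theory.
Import numFieldNormedType.Exports.

Local Open Scope classical_set_scope.
Local Open Scope ring_scope.

(** Independence says that the law of the pair agrees with the product of the marginal laws on
    measurable rectangles, and these determine a product measure. *)
Lemma independent_RVs_prob_pair (R : realType) (d d1 d2 : measure_display)
    (Omega : measurableType d) (T1 : measurableType d1)
    (T2 : measurableType d2) (P : probability Omega R)
    (X : {RV P >-> T1}) (Y : {RV P >-> T2}) (S : set (T1 * T2)) :
  independent_RVs X Y -> measurable S ->
  P [set w | S (X w, Y w)] = (\int[P]_w P (Y @^-1` xsection S (X w)))%E.
Proof.
move=> indXY mS.
have mXY : measurable_fun setT (fun w => (X w, Y w)).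
  by apply: measurable_fun_pair; exact: measurable_funPT.
pose XY : {mfun Omega >-> (T1 * T2)%type} := mfun_Sub (mem_set mXY).
rewrite -[LHS]/(distribution P XY S).
have XYE A B : measurable A -> measurable B ->
    distribution P XY (A `*` B) = (distribution P X A * distribution P Y B)%E.
  exact: indXY.
rewrite -(product_measure_unique XYE mS).
(* The product measure integrates the measures of sections against the law of [X]; a change of
   variables brings that integral back to [Omega]. *)
rewrite /product_measure1 ge0_integral_distribution//.
exact: measurable_fun_xsection.
Qed.

(** By continuity of the norm this is the preimage of an open set, a generator of the Borel
    sigma-algebra. *)
Lemma borel_measurable_norm_sub_gt (R : realType) (d : measure_display)
    (T : measurableType d) (E : normedModType R) (f : T -> E) (l : E) (e : R) :
  borel_measurable f -> measurable [set x | (e < `|f x - l|)%R].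
Proof.
move=> mf.
have oB : open [set y : E | (e < `|y - l|)%R].
  apply: (@open_comp _ _ (fun y : E => `|y - l|) [set r | e < r]).
    by move=> y _; apply: cvg_norm; apply: cvgB => //; exact: cvg_cst.
  exact: open_gt.
have mB : measurable ([set y | e < `|y - l|] : set (g_sigma_algebraType (@open E))).
  exact: sub_sigma_algebra.
by have := mf measurableT _ mB; rewrite setTI.
Qed.

Theorem proposition3 (R : realType) (d dU dV : measure_display)
    (Omega : measurableType d) (TU : measurableType dU)
    (TV : measurableType dV) (P : probability Omega R)
    (U : {RV P >-> TU}) (V : {RV P >-> TV})
    (p : nat) (betahat : nat -> TU * TV -> 'rV[R]_p) (betastar : 'rV[R]_p) :
  independent_RVs U V ->
  (forall n : nat, borel_measurable (betahat n)) ->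
  (exists UU : set TU,
     [/\ measurable (U @^-1` UU),
         P (U @^-1` UU) = 1%E &
         forall u : TU, UU u ->
           cvg_in_probability P (fun n w => betahat n (u, V w)) betastar]) ->
  cvg_in_probability P (fun n w => betahat n (U w, V w)) betastar.
Proof.
move=> indUV mbeta [UU [mUU PUU cvgUU]] e e0.
pose S n := [set x | (e < `|betahat n x - betastar|)%R].
have mS n : measurable (S n) by exact: borel_measurable_norm_sub_gt.
pose q n w := P (V @^-1` xsection (S n) (U w)).
have mq n : measurable_fun setT (q n).
  apply: (measurableT_comp (measurable_fun_xsection (distribution P V) (mS n))).
  exact: measurable_funPT.
have qE n : P [set w | S n (U w, V w)] = (\int[P]_w q n w)%E.
  exact: independent_RVs_prob_pair.
under eq_fun do rewrite qE.
have q_cvg0 : {ae P, forall w, setT w -> q ^~ w @ \oo --> 0%E}.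
  exists (~` (U @^-1` UU)); split.
  - exact: measurableC.
  - by rewrite probability_setC// PUU subee.
  - apply: subsetC => w /cvgUU /(_ _ e0) + _.
    apply: cvg_trans; apply: near_eq_cvg; apply: nearW => n.
    (* For fixed [U w], the section of [S n] is exactly the deviation event of the conditional
       hypothesis at [u = U w]. *)
    by rewrite /q; congr (P _); apply/seteqP; split => v; rewrite /xsection /= inE.
have q_le1 : {ae P, forall w n, setT w -> (`|q n w| <= cst 1 w)%E}.
  apply: aeW => w n _.
  rewrite gee0_abs//; apply: probability_le1.
  rewrite -[X in measurable X]setTI; apply: measurable_funPT => //.
  exact: measurable_xsection.
have int1 : P.-integrable setT (cst 1%E) by exact: finite_measure_integrable_cst.
(* Only the last conclusion is kept: the integrals of [q n] tend to the integral of the zero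
   function. *)
have [_ _] := dominated_convergence measurableT mq (measurable_cst 0%E)
  q_cvg0 int1 q_le1.
by rewrite integral0.
Qed.
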